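(* Let $\varphi\colon\Gamma\to G$ be a group homomorphism. If $\Gamma$ and $G$ are finite and $Z(\ker\varphi)=1$, then the normalizers tower $\Gamma=\Gamma^0\xrightarrow{\widetilde{\varphi_0}}\Gamma^1\xrightarrow{\widetilde{\varphi_1}}\Gamma^2\to\cdots$ of $\varphi$ terminates after a finite number of steps; that is, there is a non-negative integer $m$ such that $\widetilde{\varphi_i}\colon\Gamma^i\to\Gamma^{i+1}$ is an isomorphism for all $i\ge m$.
   Context: Notation: $h^g=g^{-1}hg$ in a group; $Z(H)$ is the center of $H$; automorphisms of $\Gamma$ act on the right, so in $\mathrm{Aut}(\Gamma)$ the product $\tau\sigma$ means first $\tau$, then $\sigma$; for $\gamma\in\Gamma$, $c_\gamma\in\mathrm{Aut}(\Gamma)$ is $\delta\mapsto\gamma^{-1}\delta\gamma$. The injective normalizer of a homomorphism $\varphi\colon\Gamma\to G$ is the factorization $\Gamma\xrightarrow{\widetilde\varphi}N(\varphi)\xrightarrow{p_\varphi}G$ of $\varphi$, where $N(\varphi)$ is the subgroup of $\mathrm{Aut}(\Gamma)\times N_G(\varphi(\Gamma))$ consisting of all pairs $(\tau,g)$ that are compatible, i.e. $\varphi(\gamma)^g=\varphi(\tau(\gamma))$ for all $\gamma\in\Gamma$; and $\widetilde\varphi(\gamma)=(c_\gamma,\varphi(\gamma))$, $p_\varphi(\tau,g)=g$. The normalizers tower of $\varphi$ is obtained by iteration: $\Gamma^0:=\Gamma$, $\varphi_0:=\varphi$, and for $i\ge1$, $\Gamma^i:=N(\varphi_{i-1})$,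 $\varphi_i:=p_{\varphi_{i-1}}\colon\Gamma^i\to G$, with connecting maps $\widetilde{\varphi_i}\colon\Gamma^i\to\Gamma^{i+1}=N(\varphi_i)$. (The tower can be continued transfinitely by taking direct limits at limit ordinals.) *)

(* Defs.v *)
From mathcomp Require Import all_boot all_fingroup.

Set Implicit Arguments.
Unset Strict Implicit.
Unset Printing Implicit Defensive.

Local Open Scope group_scope.

(* Groups are finite groups in the sense of MathComp, that is, subgroups       *)
(* Gamma : {group aT} and G : {group rT} of ambient finGroupTypes.  A          *)
(* homomorphism Gamma -> G is a phi : {morphism Gamma >-> rT} together with    *)
(* the inclusion phi @* Gamma \subset G.  Permutations act on the right:       *)
(* (s * t) x = t (s x).                                                        *)

Section InjectiveNormalizer.

Variables (aT rT : finGroupType) (Gamma : {group aT}) (G : {group rT}).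
Variable phi : {morphism Gamma >-> rT}.

Definition compatible (tau : {perm aT}) (g : rT) : bool :=
  [forall x in Gamma, phi x ^ g == phi (tau x)].

Definition injnorm : {set {perm aT} * rT} :=
  [set u in setX (Aut Gamma) 'N_G(phi @* Gamma) | compatible u.1 u.2].

Lemma injnormP (u : {perm aT} * rT) :
  reflect [/\ u.1 \in Aut Gamma, u.2 \in 'N_G(phi @* Gamma)
            & {in Gamma, forall x, phi x ^ u.2 = phi (u.1 x)}]
          (u \in injnorm).
Proof.
case: u => t g /=.
apply: (iffP setIdP) => [[/setXP[At Ng] /forall_inP ctg] | [At Ng ctg]].
  by split=> // x Gx; apply/eqP/ctg.
split; first exact/setXP.
by apply/forall_inP=> x Gx; apply/eqP/ctg.
Qed.

Lemma injnorm_group_set : group_set injnorm.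
Proof.
apply/group_setP; split.
  by apply/injnormP; split; rewrite ?group1 // => x _; rewrite conjg1 perm1.
move=> u v /injnormP[Au Nu cu] /injnormP[Av Nv cv].
apply/injnormP; split; rewrite ?groupM // => x Gx.
by rewrite conjgM cu // cv ?permM // (Aut_closed Au).
Qed.

Canonical injnorm_group := Group injnorm_group_set.

Definition injnorm_proj : {morphism injnorm >-> rT} :=
  [morphism of restrm (subsetT injnorm) (@snd {perm aT} rT)].

Lemma injnorm_proj_sub : injnorm_proj @* injnorm \subset G.
Proof.
apply/subsetP=> _ /morphimP[u _ /injnormP[_ Nu _] ->].
by case/setIP: Nu.
Qed.

Definition injnorm_lift_fun (x : aT) : {perm aT} * rT := (conj_aut Gamma x, phi x).

Lemma injnorm_lift_morphM : {in Gamma &, {morph injnorm_lift_fun : x y / x * y}}.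
Proof.
move=> x y Gx Gy; have nG := subsetP (normG Gamma).
by rewrite /injnorm_lift_fun conj_aut_morphM ?nG // morphM.
Qed.

Definition injnorm_lift : {morphism Gamma >-> {perm aT} * rT} :=
  Morphism injnorm_lift_morphM.

Lemma injnorm_lift_sub :
  phi @* Gamma \subset G -> injnorm_lift @* Gamma \subset injnorm.
Proof.
move=> sG; apply/subsetP=> _ /morphimP[x _ Gx ->].
apply/injnormP; split=> /= [||y Gy]; first exact: Aut_aut.
  have Nx: phi x \in phi @* Gamma by apply: mem_morphim.
  by rewrite inE (subsetP sG) // (subsetP (normG _)).
by rewrite conj_autE // morphJ.
Qed.

Lemma injnorm_factorization : {in Gamma, injnorm_proj \o injnorm_lift =1 phi}.
Proof. by []. Qed.

End InjectiveNormalizer.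

(* The source group and its ambient type change along the tower. *)
Record hom_to (rT : finGroupType) (G : {group rT}) := HomTo {
  hom_amb : finGroupType;
  hom_src : {group hom_amb};
  hom_mor : {morphism hom_src >-> rT};
  hom_sub : hom_mor @* hom_src \subset G
}.

Definition normalizer_step (rT : finGroupType) (G : {group rT})
    (h : hom_to G) : hom_to G :=
  HomTo (injnorm_proj_sub G (hom_mor h)).

Fixpoint normalizers_tower (rT : finGroupType) (G : {group rT})
    (h : hom_to G) (i : nat) : hom_to G :=
  if i is j.+1 then normalizer_step (normalizers_tower h j) else h.

(* The codomain is the ambient type of hom_src (normalizers_tower h i.+1). *)
Definition tower_map (rT : finGroupType) (G : {group rT})
    (h : hom_to G) (i : nat) :
    {morphism hom_src (normalizers_tower h i)
       >-> hom_amb (normalizers_tower h i.+1)} :=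
  injnorm_lift (hom_mor (normalizers_tower h i)).

(* Main.v *)
Require Import Defs.
From mathcomp Require Import all_boot all_fingroup all_solvable.
From Stdlib Require Import Classical_Prop.

(* Let K_i be the kernel of phi_i : Gamma^i -> G.  Each connecting map is        *)
(* injective, embeds K_i as a normal subgroup of K_{i+1}, and the centralizer of *)
(* K_i in K_{i+1} is trivial.  Hence K_0 is subnormal in K_n with trivial        *)
(* centralizer, and by the argument for Wielandt's automorphism tower theorem    *)
(* the order of K_n is bounded in terms of the order of K_0.  As Gamma^n / K_n   *)
(* embeds in G, the orders of the Gamma^n are bounded, so the injective          *)
(* connecting maps are eventually bijective.                                     *)
(*   For the bound, let S be subnormal in H with trivial centralizer.  Every     *)
(* 'O_p(H) acts faithfully on the subgroup of S generated by its p'-elements,    *)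
(* which bounds 'F(H).  The largest normal subgroup R of H that normalizes       *)
(* S 'F(H) acts faithfully on S 'F(H), so it is bounded too.  Since minimal      *)
(* normal subgroups normalize all subnormal subgroups, 'C_H(R) is contained in   *)
(* 'F(H), and H / 'C_H(R) embeds in Aut R.                                       *)

Local Open Scope group_scope.

(** One invariant serves twice: each kernel K_i has a subnormal copy of K_0 with trivial centralizer
    ([tower_cent1_subnormal]). It forces [Z(K_i) = 1], which makes the connecting map injective, and
    it bounds the order of K_i through [card_subnormal_leq]. *)

(** * Bounding a group by a subnormal subgroup with trivial centralizer *)

Lemma card_norm_leq {gT : finGroupType} (A H : {group gT}) :
  H \subset 'N(A) -> #|H| <= #|'C_H(A)| * #|A|`!.
Proof.
move=> nAH; rewrite -(LagrangeI H 'C(A)) leq_pmul2l ?cardG_gt0 //.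
have -> : #|H : 'C(A)| = #|conj_aut A @* H|.
  by rewrite card_morphim ker_conj_aut (setIidPr nAH).
rewrite -card_perm; apply/subset_leq_card; apply: subset_trans (Aut_conj_aut A H) _.
by apply/subsetP=> a /setIdP[].
Qed.

Lemma card_norm_cent1_leq {gT : finGroupType} (A H : {group gT}) :
  H \subset 'N(A) -> 'C_H(A) = 1 -> #|H| <= #|A|`!.
Proof. by move=> nAH cAH; have := card_norm_leq A H nAH; rewrite cAH cards1 mul1n. Qed.

(** Every factor of a subnormal chain from [S] to [H] has p-power index, and a p'-element dies in a
    p-group quotient, so [x] descends along the chain. *)
Lemma mem_subnormal_p'elt {gT : finGroupType} (p : nat) (S H : {group gT}) (x : gT) :
  S <|<| H -> p.-nat #|H : S| -> x \in H -> p^'.-elt x -> x \in S.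
Proof.
have [n] := ubnP #|H|; elim: n H => // n IHn H /ltnSE-leHn snSH pHS Hx p'x.
have [-> // | [K [snSK nsKH prKH]]] := subnormalEr snSH.
have [sSK [sKH nKH]] := (subnormal_sub snSK, andP nsKH).
have /andP[pHK pKS]: p.-nat #|H : K| && p.-nat #|K : S|.
  by rewrite -pnatM Lagrange_index.
apply: IHn pKS _ (p'x) => //; first exact: leq_trans (proper_card prKH) leHn.
have nKx := subsetP nKH x Hx.
apply: coset_idr (nKx) _; apply/eqP; rewrite -order_eq1; apply/eqP.
apply: (@pnat_1 p); last exact: (morph_p_elt _ nKx p'x).
by apply: (@mem_p_elt _ p _ (H / K)); rewrite ?mem_quotient // /pgroup card_quotient.
Qed.

(* [A] below plays the role of O^p(S).  It is generated by all p'-elements of  *)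
(* S 'O_p(G), hence is normalized by 'O_p(G).  A Sylow p-subgroup Q of S acts   *)
(* on the p-group 'C_('O_p(G))(A), and its fixed points there centralize        *)
(* S = A Q, hence are trivial; so 'C_('O_p(G))(A) = 1.                          *)
Lemma card_pcore_subnormal {gT : finGroupType} (p : nat) (S G : {group gT}) :
  prime p -> S <|<| G -> 'C_G(S) = 1 -> #|'O_p(G)| <= #|S|`!.
Proof.
move=> p_pr snSG cGS; set P := 'O_p(G)%G.
have sSG := subnormal_sub snSG.
have [sPG nPG] := andP (pcore_normal p G : P <| G).
have pP: p.-group P := pcore_pgroup p G.
have nPS: S \subset 'N(P) := subset_trans sSG nPG.
set A := <<[set x in S | p^'.-elt x]>>%G.
have sAS: A \subset S by rewrite gen_subG; apply/subsetP=> x /setIdP[].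
have snSH: S <|<| S <*> P.
  have sSH := joing_subl S P.
  have := setI_subnormal (_ : S <*> P \subset G) snSG.
  by rewrite (setIidPl sSH) join_subG sSG sPG; apply.
have pHS: p.-nat #|S <*> P : S|.
  rewrite norm_joinEl // indexMg -indexgI; exact: pnat_dvd (dvdn_indexg _ _) pP.
have nAS: S \subset 'N(A).
  apply: norms_gen; apply/subsetP=> y Sy; rewrite inE.
  apply/subsetP=> _ /imsetP[x Ax ->]; move: Ax.
  by rewrite !inE => /andP[Sx p'x]; rewrite groupJ // p_eltJ.
have nAP: P \subset 'N(A).
  apply: norms_gen; apply/subsetP=> y Py; rewrite inE.
  apply/subsetP=> _ /imsetP[x Ax ->]; move: Ax.
  rewrite !inE => /andP[Sx p'x]; rewrite p_eltJ p'x andbT.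
  apply: (@mem_subnormal_p'elt _ p _ (S <*> P)); rewrite ?p_eltJ //.
  exact: groupJ (subsetP (joing_subl S P) x Sx) (subsetP (joing_subr S P) y Py).
suff cPA: 'C_P(A) = 1.
  apply: leq_trans (card_norm_cent1_leq A P nAP cPA) _.
  exact/leq_fact/subset_leq_card.
have [Q sylQ] := Sylow_exists p S; have [sQS pQ _] := and3P sylQ.
(* Compare orders prime by prime: [Q] supplies the p-part, and the other Sylow subgroups of [S]
   consist of p'-elements, so they lie in [A]. *)
have sS_AQ: S \subset A <*> Q.
  have sAQS: A <*> Q \subset S by rewrite join_subG sAS.
  suff /(dvdn_leq (cardG_gt0 _)) leS: #|S| %| #|A <*> Q|.
    by have /eqP-> : A <*> Q == S :> {set gT} by rewrite eqEcard sAQS.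
  apply/dvdn_partP=> // q _; have [-> | neq_qp] := eqVneq q p.
    by rewrite -(card_Hall sylQ) cardSg ?joing_subr.
  have [R sylR] := Sylow_exists q S; have [sRS qR _] := and3P sylR.
  rewrite -(card_Hall sylR) cardSg // (subset_trans _ (joing_subl A Q)) //.
  apply/subsetP=> x Rx; rewrite mem_gen // inE (subsetP sRS) //=.
  by apply: sub_in_pnat (mem_p_elt qR Rx) => r _ /eqnP->.
apply/eqP; apply: contraTT (pQ) => ntC.
have nCQ: Q \subset 'N('C_P(A)).
  by rewrite normsI ?(subset_trans sQS) // norms_cent.
have pC: p.-group 'C_P(A) := pgroupS (subsetIl _ _) pP.
have pH: p.-group (Q <*> 'C_P(A)) by rewrite norm_joinEl // pgroupM pQ.
have nsCH: 'C_P(A) <| Q <*> 'C_P(A) by rewrite /normal joing_subr join_subG nCQ normG.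
case/negP: (meet_center_nil (pgroup_nil pH) nsCH ntC).
rewrite -subG1 -cGS; apply/subsetP=> z /setIP[/setIP[Pz cAz] /setIP[_ cHz]].
rewrite inE (subsetP sPG) //= (subsetP (centS sS_AQ)) // centY inE cAz.
by apply: subsetP cHz; rewrite centS ?joing_subl.
Qed.

Lemma card_Fitting_subnormal {gT : finGroupType} (S G : {group gT}) :
  S <|<| G -> 'C_G(S) = 1 -> #|'F(G)| <= (#|S|`!)`!.
Proof.
move=> snSG cGS; apply: dvdn_leq (fact_gt0 _) _.
apply/dvdn_partP=> [//|p]; rewrite mem_primes => /and3P[p_pr _ _].
rewrite -(card_Hall (nilpotent_pcore_Hall p (Fitting_nil G))) /= p_core_Fitting.
by rewrite dvdn_fact // cardG_gt0 card_pcore_subnormal.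
Qed.

(* If [S] lies in a proper normal subgroup [K] of [G], then either [M]          *)
(* centralizes [K], or [M] is generated by the [G]-conjugates of a minimal      *)
(* normal subgroup of [K], to which induction applies.                          *)
Lemma minnormal_norm_subnormal {gT : finGroupType} (M S G : {group gT}) :
  minnormal M G -> M \subset G -> S <|<| G -> M \subset 'N(S).
Proof.
have [n] := ubnP #|G|; elim: n G M => // n IHn G M /ltnSE-leGn minM sMG snSG.
have [-> | [K [snSK nsKG prKG]]] := subnormalEr snSG.
  exact: subset_trans sMG (normG G).
have [/andP[ntM nMG] min_M] := mingroupP minM; have [sKG nKG] := andP nsKG.
have sSK := subnormal_sub snSK.
have nsMG: M <| G by rewrite /normal sMG.
have [tiMK | ntMK] := eqVneq (M :&: K) 1.
  apply/cents_norm/(subset_trans _ (centS sSK)); apply/commG1P/trivgP.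
  rewrite -tiMK commg_subI // subsetI ?subxx ?(subset_trans sMG) //.
  exact: subset_trans sKG nMG.
have{ntMK} sMK: M \subset K.
  by apply/setIidPl/min_M; rewrite ?subsetIl // ntMK normsI.
have [L minL sLM] := minnormal_exists ntM (subset_trans sKG nMG).
have [/andP[ntL nLK] _] := mingroupP minL.
have nsKx x: x \in G -> K :^ x = K by move/(subsetP nKG)/normP.
have <-: <<class_support L G>> = M.
  apply: min_M; last first.
    by rewrite gen_subG class_support_sub_norm.
  rewrite norms_gen ?class_support_norm // andbT -subG1 gen_subG.
  by apply: contra ntL => /(subset_trans (sub_class_support G L)); rewrite subG1.
rewrite gen_subG class_supportEr; apply/bigcupsP=> x Gx.
have sLxK: L :^ x \subset K by rewrite -(nsKx x Gx) conjSg (subset_trans sLM).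
apply: (IHn K (L :^ x)%G) => //; first exact: leq_trans (proper_card prKG) leGn.
have := injm_minnormal (injm_conj K x) (subset_trans sLM sMK) (subxx K).
by rewrite !morphim_conj setIid (setIidPr (subset_trans sLM sMK)) nsKx // => ->.
Qed.

(* Write [R] for the gcore.  Otherwise take [V / 'F(G)] minimal normal in       *)
(* [G / 'F(G)] and contained in the image of ['C_G(R)].  Then [V] lies in [R],  *)
(* so [V :&: 'C(R)] is abelian and normal in [G], hence contained in ['F(G)].   *)
Lemma cent_gcore_sub_Fitting {gT : finGroupType} (S G : {group gT}) :
  S <|<| G -> 'C_G(gcore 'N_G(S <*> 'F(G)) G) \subset 'F(G).
Proof.
move=> snSG; set F := 'F(G)%G; set R := gcore_group 'N_G(S <*> F) G.
set C := 'C_G(R)%G.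
have [sFG nFG] := andP (Fitting_normal G : F <| G).
have sSG := subnormal_sub snSG.
have nsRG: R <| G by rewrite gcore_normal ?subsetIl.
have nsCG: C <| G.
  by rewrite /normal subsetIl normsI ?normG // norms_cent ?normal_norm.
have [sCG nCG] := andP nsCG.
have nFS := subset_trans sSG nFG.
rewrite -quotient_sub1 ?(subset_trans sCG) // subG1; apply: contraT => ntC.
have [M minM sMC] := minnormal_exists ntC (quotient_norms F nCG).
have [/andP[ntM nMG] _] := mingroupP minM.
have sMG: M \subset G / F by rewrite (subset_trans sMC) // quotientS.
have [V defM sFV sVG] := inv_quotientS (Fitting_normal G) sMG.
have nFV := subset_trans sVG nFG.
have nVG: G \subset 'N(V).
  rewrite -(quotientSGK nFG) ?(subset_trans sFV (normG V)) //.
  by rewrite quotient_normG -?defM // /normal sFV.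
have sVR: V \subset R.
  apply: gcore_max nVG; rewrite subsetI sVG.
  have sFSF: F \subset S <*> F := joing_subr S F.
  rewrite -(quotientSGK nFV) ?(subset_trans sFSF (normG _)) //.
  rewrite quotient_normG -?defM; last by rewrite /normal sFSF join_subG nFS normG.
  rewrite quotientYidr //.
  exact: minnormal_norm_subnormal minM sMG (quotient_subnormal F snSG).
have sVCF: V :&: C \subset F.
  apply: Fitting_max; first by rewrite normalI // /normal sVG.
  apply: abelian_nil; apply: subset_trans (subsetIr _ _) _.
  apply: subset_trans (subsetIr _ _) (centS _).
  exact: subset_trans (subsetIl _ _) sVR.
case/negP: ntM; rewrite -subG1 -(setIidPl sMC) defM setIC -quotientIG // setIC.
by rewrite quotient_sub1 // (subset_trans (subsetIl _ _)).
Qed.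

(** Iterated factorials: the first factor bounds ['F(G)]; [n * n]![!] bounds [S 'F(G)], its
    factorial bounds [R], and one more bounds [Aut R]. *)
Definition subnormal_bound (n : nat) : nat :=
  (n`!`! * (n * n`!`!)`!`!)%N.

Lemma card_subnormal_leq {gT : finGroupType} (S G : {group gT}) :
  S <|<| G -> 'C_G(S) = 1 -> #|G| <= subnormal_bound #|S|.
Proof.
move=> snSG cGS; set R := gcore_group 'N_G(S <*> 'F(G)) G.
have sRG: R \subset G := subset_trans (gcore_sub _ _) (subsetIl _ _).
have leF := card_Fitting_subnormal S G snSG cGS.
have leSF: #|S <*> 'F(G)| <= #|S| * #|S|`!`!.
  apply: leq_trans (leq_mul (leqnn _) leF); rewrite norm_joinEl.
    by rewrite mul_cardG leq_pmulr ?cardG_gt0.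
  exact: subset_trans (subnormal_sub snSG) (normal_norm (Fitting_normal G)).
have leR: #|R| <= #|S <*> 'F(G)|`!.
  apply: card_norm_cent1_leq.
    exact: subset_trans (gcore_sub _ _) (subsetIr _ _).
  by apply/trivgP; rewrite -cGS setISS // centS ?joing_subl.
apply: leq_trans (card_norm_leq R G (gcore_norm _ _)) _.
apply: leq_mul; last exact/leq_fact/(leq_trans leR)/leq_fact.
exact: leq_trans (subset_leq_card (cent_gcore_sub_Fitting S G snSG)) leF.
Qed.

(** If [T] follows [S] in a subnormal chain up to [K], induction gives ['C_L(T) = 1]. Since [T]
    normalizes ['C_L(S)], their commutator lies in ['C_K(S) = 1], so ['C_L(S)] centralizes [T]. *)
Lemma cent1_subnormal_normal {gT : finGroupType} (S K L : {group gT}) :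
  S <|<| K -> K <| L -> 'C_K(S) = 1 -> 'C_L(K) = 1 -> 'C_L(S) = 1.
Proof.
move=> snSK /andP[sKL nKL]; have [n] := ubnP (#|K| - #|S|).
elim: n S snSK => // n IHn S snSK /ltnSE-leSn cKS cLK.
have [-> // | [T [/andP[sST nST] snTK prST]]] := subnormalEl snSK.
have sTK := subnormal_sub snTK.
have cLT: 'C_L(T) = 1.
  apply: IHn => //; last by apply/trivgP; rewrite -cKS setIS // centS.
  have ltST := proper_card prST; apply: leq_trans leSn.
  by apply: ltn_sub2l (ltST); apply: leq_trans ltST _; apply: subset_leq_card.
apply/trivgP; rewrite -cLT subsetI subsetIl /=; apply/commG1P/trivgP.
have nCT: T \subset 'N('C_L(S)).
  by rewrite normsI ?norms_cent // (subset_trans _ (normG L)) // (subset_trans sTK).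
have nKC: 'C_L(S) \subset 'N(K) := subset_trans (subsetIl _ _) nKL.
have sCT: [~: 'C_L(S), T] \subset 'C_L(S) :&: K.
  by rewrite commg_subI // subsetI ?subxx ?sTK.
rewrite -cKS; apply: subset_trans sCT _.
by rewrite subsetI subsetIr (subset_trans (subsetIl _ _) (subsetIr _ _)).
Qed.

(** * Kernels along the tower *)

Section InjectiveNormalizerKernel.

Context {aT rT : finGroupType} {Gamma : {group aT}}.
Variables (G : {group rT}) (phi : {morphism Gamma >-> rT}).
Hypotheses (phiG : phi @* Gamma \subset G) (Zker : 'Z('ker phi) = 1).

Local Notation K := ('ker phi).
Local Notation lift := (injnorm_lift phi).
Local Notation proj := (injnorm_proj G phi).

(** An element killed by [lift] lies in [K] and centralizes all of [Gamma], hence lies in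
    ['Z(K)]. *)
Lemma injm_injnorm_lift : 'injm lift.
Proof.
apply/subsetP=> x Kx; have Gx := dom_ker Kx.
have [cx px] : conj_aut Gamma x = 1 /\ phi x = 1 by case: (mker Kx).
suff : x \in 'Z(K) by rewrite Zker.
apply/setIP; split; first exact/kerP.
apply/centP=> y /dom_ker Gy; apply/commute_sym/commgP/conjg_fixP.
by rewrite -(conj_autE Gx Gy) cx perm1.
Qed.

Lemma injnorm_liftJ u x :
  u \in injnorm G phi -> x \in Gamma -> lift x ^ u = lift (u.1 x).
Proof.
move=> /injnormP[Au _ cu] Gx.
have Gux: u.1 x \in Gamma by rewrite (Aut_closed Au).
congr (_, _); last exact: cu.
rewrite -[LHS]/(conj_aut Gamma x ^ u.1).
apply: (@eq_Aut _ Gamma); rewrite ?groupJ ?Aut_aut // => y Gy.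
have /= [z Gz ->]: exists2 z, z \in Gamma & y = u.1 z.
  by exists ((u.1)^-1 y); rewrite ?permKV // (Aut_closed (groupVr Au)).
rewrite permJ !conj_autE ?(Aut_closed Au) //.
by rewrite -!(autmE Au) morphJ.
Qed.

Lemma ker_injnorm_projP u :
  reflect (u \in injnorm G phi /\ u.2 = 1) (u \in 'ker proj).
Proof.
apply: (iffP idP) => [Ku | [Nu u1]]; last exact/kerP.
by split; [apply: dom_ker Ku | apply: mker Ku].
Qed.

Lemma injnorm_lift_ker_sub : lift @* K \subset 'ker proj.
Proof.
apply/subsetP=> _ /morphimP[x Gx Kx ->]; apply/ker_injnorm_projP.
split; last exact: mker Kx.
exact: subsetP (injnorm_lift_sub phiG) _ (mem_morphim lift Gx Gx).
Qed.

Lemma injnorm_lift_ker_normal : lift @* K <| 'ker proj.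
Proof.
rewrite /normal injnorm_lift_ker_sub /=; apply/normsP=> u /dom_ker Nu.
apply/normP; rewrite inE; apply/subsetP=> _ /imsetP[_ /morphimP[x Gx Kx ->] ->].
have /injnormP[Au _ cu] := Nu.
rewrite injnorm_liftJ // mem_morphim ?(Aut_closed Au) //.
by apply/kerP; rewrite ?(Aut_closed Au) // -cu // (mker Kx) conj1g.
Qed.

(* If [tau] fixes [K] pointwise and [tau x = x * k] with [k] in [K], then [x]   *)
(* and [x * k] induce the same automorphism of [K], so that [k] is in ['Z(K)].  *)
Lemma cent_injnorm_lift_ker : 'C_('ker proj)(lift @* K) = 1.
Proof.
apply/trivgP/subsetP=> u /setIP[/ker_injnorm_projP[Nu u2] /centP cKu].
have /injnormP[Au _ cu] := Nu.
have fixK y : y \in K -> u.1 y = y.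
  move=> Ky; have Gy := dom_ker Ky; apply: (injmP injm_injnorm_lift).
  - by rewrite (Aut_closed Au).
  - by [].
  rewrite -injnorm_liftJ //; apply/conjg_fixP/commgP/commute_sym/cKu.
  exact: mem_morphim.
suff u1: u.1 = 1 by rewrite inE; case: u u1 u2 {Nu cKu Au cu fixK} => t g /= -> ->.
apply: (eq_Aut Au (group1 _)) => x Gx; rewrite perm1.
have Gux: u.1 x \in Gamma by rewrite (Aut_closed Au).
suff: x^-1 * u.1 x \in 'Z(K).
  by rewrite Zker => /set1gP/(canRL (mulKVg _)); rewrite mulg1.
have Kk: x^-1 * u.1 x \in K.
  apply/kerP; rewrite ?groupM ?groupV // morphM ?groupV // morphV //.
  by rewrite -cu // u2 conjg1 mulVg.
rewrite inE Kk; apply/centP=> y Ky.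
apply/commute_sym/commgP/conjg_fixP; rewrite conjgM.
have Kz: y ^ x^-1 \in K by rewrite memJ_norm // groupV (subsetP (ker_norm phi)).
(* As [u.1] fixes [y ^ x^-1], conjugating it by [u.1 x] gives [u.1 y], which is [y]. *)
by rewrite -{1}(fixK _ Kz) -(autmE Au) -morphJ ?(dom_ker Kz) // conjgKV /= autmE fixK.
Qed.

End InjectiveNormalizerKernel.

Lemma normalizer_step_cent1_subnormal {rT : finGroupType} {G : {group rT}}
    (h : hom_to G) (S : {group hom_amb h}) :
  S <|<| 'ker (hom_mor h) -> 'C_('ker (hom_mor h))(S) = 1 ->
  exists T : {group hom_amb (normalizer_step h)},
    [/\ #|T| = #|S|, T <|<| 'ker (hom_mor (normalizer_step h))
      & 'C_('ker (hom_mor (normalizer_step h)))(T) = 1].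
Proof.
case: h S => aT Gamma phi phiG S /= snSK cKS.
have sSK := subnormal_sub snSK.
have Zker: 'Z('ker phi) = 1.
  by apply/trivgP; rewrite -cKS setIS // centS.
have sSG := subset_trans sSK (normal_sub (ker_normal phi)).
have injl := injm_injnorm_lift phi Zker.
exists (injnorm_lift phi @* S)%G.
have snSL := morphim_subnormal (injnorm_lift phi) snSK.
have nsLK := injnorm_lift_ker_normal G phi phiG.
split; first exact: card_injm.
  exact: subnormal_trans snSL (normal_subnormal nsLK).
apply: cent1_subnormal_normal snSL nsLK _ _; last exact: cent_injnorm_lift_ker.
by rewrite -injm_subcent // cKS morphim1.
Qed.

Lemma tower_cent1_subnormal {rT : finGroupType} {G : {group rT}} (h : hom_to G) (i : nat) :
  'Z('ker (hom_mor h)) = 1 ->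
  exists S : {group hom_amb (normalizers_tower h i)},
    [/\ #|S| = #|'ker (hom_mor h)|, S <|<| 'ker (hom_mor (normalizers_tower h i))
      & 'C_('ker (hom_mor (normalizers_tower h i)))(S) = 1].
Proof.
move=> Zker; elim: i => [|i [S [oS snS cS]]].
  by exists ('ker (hom_mor h))%G; rewrite ?subnormal_refl.
have [T [oT snT cT]] := normalizer_step_cent1_subnormal _ S snS cS.
by exists T; rewrite oT.
Qed.

(** * Termination *)

Lemma nondecreasing_bounded_stable (u : nat -> nat) (B : nat) :
  (forall i, u i <= u i.+1) -> (forall i, u i <= B) ->
  exists m, forall i, m <= i -> u i = u i.+1.
Proof.
move=> u_mono u_leB; have [n] := ubnP (B - u 0).
suff IH k: B - u k < n -> exists m, forall i, m <= i -> u i = u i.+1 by apply: (IH 0).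
elim: n k => // n IHn k /ltnSE-le_n.
(* Excluded middle is used because a later strict increase cannot be searched for; each one shrinks
   the gap [B - u k]. *)
have [[i [le_ki lt_u]] | no_i] := classic (exists i, k <= i /\ u i < u i.+1).
  have lt_ki: u k < u i.+1.
    apply: leq_ltn_trans lt_u.
    exact: (homo_leq (r := leq) leqnn (fun x y z => @leq_trans x y z) u_mono).
  apply: (IHn i.+1); apply: leq_trans le_n; apply: ltn_sub2l (lt_ki).
  exact: leq_trans lt_ki (u_leB _).
exists k => i le_ki; apply/eqP; rewrite eqn_leq u_mono leqNgt.
by apply/negP=> lt_u; apply: no_i; exists i.
Qed.

Theorem theorem1p11 (aT rT : finGroupType) (Gamma : {group aT}) (G : {group rT})
    (phi : {morphism Gamma >-> rT}) (phiG : phi @* Gamma \subset G)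
    (Zker : 'Z('ker phi) = 1) :
  exists m : nat, forall i : nat, (m <= i)%N ->
    isom (hom_src (normalizers_tower (HomTo phiG) i))
         (hom_src (normalizers_tower (HomTo phiG) i.+1))
         (tower_map (HomTo phiG) i).
Proof.
set h := HomTo phiG; pose gam i := hom_src (normalizers_tower h i).
have inj_map i: 'injm (tower_map h i).
  have [S [_ snS cS]] := tower_cent1_subnormal h i Zker.
  apply: injm_injnorm_lift; apply/trivgP; rewrite -cS setIS // centS //.
  exact: subnormal_sub.
have sub_map i: tower_map h i @* gam i \subset gam i.+1.
  exact/injnorm_lift_sub/hom_sub.
have card_map i: #|tower_map h i @* gam i| = #|gam i| by apply: card_injm.
have [||m stable] := @nondecreasing_bounded_stable
  (fun i => #|gam i|) (subnormal_bound #|'ker phi| * #|G|).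
- by move=> i; rewrite -card_map subset_leq_card.
- move=> i; have [S [<- snS cS]] := tower_cent1_subnormal h i Zker.
  pose f := hom_mor (normalizers_tower h i).
  rewrite -(Lagrange (normal_sub (ker_normal f))) leq_mul ?card_subnormal_leq //.
  have := card_morphim f (gam i); rewrite setIid => <-.
  exact/subset_leq_card/hom_sub.
exists m => i le_mi; apply/isomP; split=> //.
apply/eqP; rewrite eqEcard sub_map.
exact/eq_leq/(etrans (esym (stable i le_mi)) (esym (card_map i))).
Qed.
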